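(* For any graph $G$, $d(G) \geq \delta(G)$, where $\delta(G)$ denotes the minimum degree of $G$.
   Context: Graphs are finite and simple. The deduction game on a graph $G$: a layout is a placement of searchers on vertices of $G$ (a vertex may receive several searchers). A vertex is occupied in the layout if it contains at least one searcher, and unoccupied otherwise. A vertex is protected if it is occupied in the initial layout or if a searcher has moved there at some point, and unprotected otherwise. A vertex is fireable if the number of searchers on it is greater than or equal to the number of its unprotected neighbours. Initially every searcher is mobile; once a searcher has moved once, it becomes immobile (cannot move again). At each stage, simultaneously, for every fireable vertex $v$ containing mobile searchers, one searcher moves from $v$ to each unprotected neighbour of $v$ (excess searchers stay on $v$; several fireable vertices may send a searcher to the same target). Stages continue until no new searchers move. The layout is successful if at the end all vertices of $G$ are protected. The deduction number $d(G)$ is the minimum number of searchers in a successful layout on $G$. *)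

(* Defs.v *)
From mathcomp Require Import all_boot.

Set Implicit Arguments.
Unset Strict Implicit.
Unset Printing Implicit Defensive.

Record sgraph := SGraph {
  vertex :> finType;
  adj : rel vertex;
  adj_sym : symmetric adj;
  adj_irrefl : irreflexive adj }.

Definition neighbours (G : sgraph) (v : G) : {set G} := [set w | adj v w].

Definition degree (G : sgraph) (v : G) : nat := #|neighbours v|.

(* Every degree is less than #|G|, so the default value only matters for the *)
(* graph without vertices, whose minimum degree is 0 by convention.          *)
Definition min_degree (G : sgraph) : nat := \big[minn/#|G|]_(v : G) degree v.

(* [L i] is the vertex on which the [i]-th of the [k] searchers is placed. *)
Definition layout (G : sgraph) (k : nat) := {ffun 'I_k -> G}.

Section Game.

Variable G : sgraph.

Record state := State {
  mobile : {ffun G -> nat};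
  immobile : {ffun G -> nat};
  protected : {set G} }.

Definition searchers (s : state) (v : G) : nat := mobile s v + immobile s v.

Definition unprotected_neighbours (s : state) (v : G) : {set G} :=
  neighbours v :\: protected s.

Definition fireable (s : state) (v : G) : bool :=
  #|unprotected_neighbours s v| <= searchers s v.

(* During the stage that starts in state [s], a searcher goes from v to w. *)
Definition moves (s : state) (v w : G) : bool :=
  [&& fireable s v, 0 < mobile s v & w \in unprotected_neighbours s v].

(* The truncated subtraction is exact in every state reached from a layout,  *)
(* by [moves_le_mobile] below.                                               *)
Definition stage (s : state) : state :=
  State [ffun v => mobile s v - #|[set w | moves s v w]|]
        [ffun w => immobile s w + #|[set v | moves s v w]|]
        (protected s :|: [set w | [exists v, moves s v w]]).

Definition halted (s : state) : bool := ~~ [exists v, exists w, moves s v w].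

Definition initial k (L : layout G k) : state :=
  State [ffun v => #|[set i | L i == v]|] [ffun=> 0] [set L i | i in 'I_k].

Definition state_after k (L : layout G k) (n : nat) : state :=
  iter n stage (initial L).

Lemma moves_le_mobile k (L : layout G k) n v :
  #|[set w | moves (state_after L n) v w]| <= mobile (state_after L n) v.
Proof.
have inv : 0 < mobile (state_after L n) v ->
    (immobile (state_after L n) v == 0) && (v \in protected (state_after L n)).
  elim: n => [|n]; rewrite /state_after /=.
    rewrite !ffunE card_gt0 => /set0Pn[i]; rewrite inE => /eqP <-.
    by rewrite eqxx imset_f.
  set s := iter n _ _ => IHn; rewrite !ffunE => lt0m.
  have /IHn/andP[/eqP-> vP] := leq_trans lt0m (leq_subr _ _).
  rewrite inE vP andbT add0n cards_eq0; apply/eqP/setP=> u.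
  by rewrite !inE /moves inE vP !andbF.
move: inv; set s := state_after L n => inv.
have [->|[w]] := set_0Vmem [set w | moves s v w].
  by rewrite cards0.
rewrite inE => /and3P[fv mv _]; case/andP: (inv mv) => /eqP im0 _.
apply: leq_trans (_ : #|unprotected_neighbours s v| <= _).
  by apply/subset_leq_card/subsetP=> u; rewrite inE => /and3P[].
by move: fv; rewrite /fireable /searchers im0 addn0.
Qed.

Lemma game_halts k (L : layout G k) : exists n, halted (state_after L n).
Proof.
suff {L} H m s : #|~: protected s| <= m -> exists n, halted (iter n stage s).
  exact: H (leqnn _).
elim: m s => [|m IHm] s les; case: (boolP (halted s)) => [|/negPn]; try by exists 0.
  case/existsP=> v /existsP[w /and3P[_ _]]; rewrite inE => /andP[wP _].
  by move: les; rewrite leqn0 cards_eq0 => /eqP/setP/(_ w); rewrite !inE wP.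
case/existsP=> v /existsP[w vw].
have wP : w \notin protected s by case/and3P: vw => _ _; rewrite inE => /andP[].
have /IHm[n hn] : #|~: protected (stage s)| <= m.
  rewrite -ltnS; apply: leq_trans les; apply: proper_card; apply/properP; split.
    by rewrite setCS subsetUl.
  exists w; rewrite !inE ?wP // negbK; apply/orP; right.
  by apply/existsP; exists v.
by exists n.+1; rewrite iterSr.
Qed.

Definition final k (L : layout G k) : state :=
  state_after L (ex_minn (game_halts L)).

Definition successful k (L : layout G k) : bool :=
  protected (final L) == [set: G].

Lemma exists_successful : exists k, [exists L : layout G k, successful L].
Proof.
exists #|G|; apply/existsP; exists [ffun i => enum_val i].
rewrite /successful /final; set L := [ffun _ => _]; set n := ex_minn _.
have: protected (initial L) = [set: G].
  apply/setP=> v; rewrite inE; apply/imsetP; exists (enum_rank v) => //.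
  by rewrite ffunE enum_rankK.
rewrite /state_after; elim: n => [|n IHn] /= L1; first by rewrite L1.
by rewrite (eqP (IHn L1)) setTU.
Qed.

Definition deduction_number : nat := ex_minn exists_successful.

End Game.

(* Main.v *)
Require Import Defs.
From mathcomp Require Import all_boot.

(** The bound is already forced by the first stage of a successful game.  If a
    vertex v fires in that stage, its own searchers are at least as many as its
    unoccupied neighbours, while each remaining neighbour holds at least one
    searcher of its own; as v is not its own neighbour, these searchers are
    all distinct, so there are at least degree v of them
    ([first_move_degree_leq]).  If no vertex fires, the game is over at once
    and success means that every vertex is occupied, so that there are at
    least #|G| searchers ([initially_halted_card_leq]). *)

Lemma bigminn_leq (I : eqType) (r : seq I) (F : I -> nat) d i :
  i \in r -> \big[minn/d]_(j <- r) F j <= F i.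
Proof.
elim: r => // j r IHr; rewrite inE big_cons => /predU1P[->|/IHr].
  exact: geq_minl.
exact/leq_trans/geq_minr.
Qed.

Lemma min_degree_leq_degree (G : sgraph) (v : G) : min_degree G <= degree v.
Proof. exact/bigminn_leq/mem_index_enum. Qed.

Lemma min_degree_leq_card (G : sgraph) : min_degree G <= #|G|.
Proof.
rewrite /min_degree; elim/big_rec: _ => // v m _.
exact/leq_trans/geq_minr.
Qed.

(** Each neighbour of v is paid for by a searcher: an unoccupied one by a
    searcher on v, as v is fireable, and an occupied one by a searcher on it. *)
Lemma first_move_degree_leq (G : sgraph) k (L : layout G k) (v w : G) :
  moves (initial L) v w -> degree v <= k.
Proof.
case/and3P=> + _ _; rewrite /fireable /searchers !ffunE addn0.
rewrite /degree -(cardsID (protected (initial L)) (neighbours v)) => fire.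
set on_v := [set i | L i == v] in fire.
pose near_v := [set i | L i \in neighbours v].
have occupied : #|neighbours v :&: protected (initial L)| <= #|near_v|.
  apply: leq_trans (leq_imset_card L near_v).
  apply/subset_leq_card/subsetP=> u; rewrite inE => /andP[uN /imsetP[i _ def_u]].
  by apply/imsetP; exists i; rewrite // inE -def_u.
have disj : near_v :&: on_v = set0.
  apply/setP=> i; rewrite !inE; apply/negP=> /andP[vLi /eqP Li].
  by rewrite Li adj_irrefl in vLi.
apply: leq_trans (leq_add occupied fire) _.
by rewrite -cardsUI disj cards0 addn0 -[leqRHS]card_ord max_card.
Qed.

(** The final state is the first halted one, here the layout itself, so the
    protected vertices are exactly those that hold a searcher. *)
Lemma initially_halted_card_leq (G : sgraph) k (L : layout G k) :
  halted (initial L) -> successful L -> #|G| <= k.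
Proof.
move=> halt0; rewrite /successful /final.
case: ex_minnP => n _ /(_ 0 halt0); rewrite leqn0 => /eqP-> /eqP /= occ.
by rewrite -cardsT -occ -[leqRHS]card_ord leq_imset_card.
Qed.

Theorem theorem3p4 (G : sgraph) : min_degree G <= deduction_number G.
Proof.
rewrite /deduction_number; case: ex_minnP => k /existsP[L succL] _.
have [halt0 | ] := boolP (halted (initial L)).
  exact: leq_trans (min_degree_leq_card G) (initially_halted_card_leq _ _ _ halt0 succL).
case/negPn/existsP=> v /existsP[w vw].
exact: leq_trans (min_degree_leq_degree _ v) (first_move_degree_leq _ _ _ _ _ vw).
Qed.
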